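(* Let $G=(\mathcal H,\mathcal V)$ be a two-dimensional graph on a finite vertex set, with adjacency matrices $H$ and $V$, and let $X_G$ be the two-dimensional shift space generated by $G$. Suppose that for all vertices $i,j$ one has $(HV)_{ij}\neq 0 \Leftrightarrow (VH)_{ij}\neq 0$. Then $X_G$ is horizontally transitive if and only if either (i) $H_k$ is irreducible for all $k\in\mathbb N$, or (ii) for all $k\in\mathbb N$, $H_k$ has exactly two irreducible permutation sub-matrices $A_{1k},A_{2k}$, and these are such that for any $i\in A_{1k}$ and $j\in A_{2k}$ there exists a unique path connecting the two vertices (from $i$ to $j$), this path traversing all the vertices of $H_k\setminus(A_{1k}\cup A_{2k})$.
   Context: A two-dimensional graph $G=(\mathcal H,\mathcal V)$ is a pair of finite directed graphs (loops allowed, no multiple edges) on a common vertex set $A$, with $0$-$1$ adjacency matrices $H$ (for $\mathcal H$) and $V$ (for $\mathcal V$). It generates $X_G=\{x\in A^{\mathbb Z^2}: H_{x(m,n)\,x(m+1,n)}=1 \text{ and } V_{x(m,n)\,x(m,n+1)}=1 \text{ for all } (m,n)\in\mathbb Z^2\}$, with the subspace topology of the product topology on $A^{\mathbb Z^2}$ ($A$ discrete). Shift spaces (subshifts) are by definition non-empty, closed and shift-invariant. For $a\in\mathbb Z^2$, $(\sigma^a x)(k)=x(k+a)$. $Q_k$ is the set of valid $k\times 1$ patterns (vertical columns $(c_1,\dots,c_k)\in A^k$, read from bottom to top, with $V_{c_tc_{t+1}}=1$ for $1\le t<k$), and $H_k$ is the $0$-$1$ matrix indexed by $Q_k$ recording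 horizontal compatibility: $(H_k)_{c,d}=1$ iff $H_{c_td_t}=1$ for all $1\le t\le k$. In particular $H_1=H$. $X_G$ is horizontally transitive if for any non-empty open $U,W\subseteq X_G$ there is $p\in\mathbb Z$ with $\sigma^{(p,0)}(U)\cap W\neq\emptyset$. A non-negative square matrix $M$ is irreducible if for every pair of indices $i,j$ there is $k\in\mathbb N=\{1,2,\dots\}$ with $(M^k)_{ij}\neq 0$. $H_k$ is regarded as the adjacency matrix of a directed graph with vertex set $Q_k$. Sub-matrices are principal sub-matrices, identified with the sets of vertices indexing them; $H_k\setminus(A_{1k}\cup A_{2k})$ is the set of vertices indexing neither. A path is a directed path without repeated vertices.
   Formalization: Both graphs are assumed essential (every vertex has an incoming and an outgoing edge in each), without which the claim fails; (ii) is read as: A_{1k}, A_{2k} are the only irreducible principal sub-matrices of H_k and both are permutation matrices. *)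

(* Defs.v *)
(* MathComp with MathComp-Analysis *)
From HB Require Import structures.
From mathcomp Require Import all_boot all_order all_algebra.
From mathcomp Require Import all_classical all_reals all_analysis.
Set Implicit Arguments.
Unset Strict Implicit.
Unset Printing Implicit Defensive.
Import Order.TTheory GRing.Theory Num.Theory.
Local Open Scope classical_set_scope.
Local Open Scope ring_scope.

(* A pair of directed graphs (loops allowed, no multiple edges) on A. *)
Record graph2 (A : finType) := Graph2 { hor : rel A; ver : rel A }.

(* Rows and columns follow the enumeration of T. *)
Definition adjmx (T : finType) (e : rel T) : 'M[nat]_#|T| :=
  \matrix_(i, j) (e (enum_val i) (enum_val j) : nat).

(* No stranded vertex.  A stranded vertex occurs in no configuration but still
   indexes rows of the column matrices: for hor = ver = {(a, a)} on {a, b} the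
   shift space is one point, hence transitive, and [[1, 0], [0, 0]] is reducible
   with a single irreducible sub-matrix. *)
Definition essential (T : finType) (e : rel T) : Prop :=
  forall v, (exists w, e v w) /\ (exists w, e w v).

Definition config (A : finType) : Type := {ptws int * int -> discrete_topology A}.

Definition translate (A : finType) (a : int * int) (x : config A) : config A :=
  fun k => x (k + a).

Definition shift_space (A : finType) (G : graph2 A) : set (config A) :=
  [set x | forall m n : int,
     hor G (x (m, n)) (x (m + 1, n)) /\ ver G (x (m, n)) (x (m, n + 1))].

(* Openness in the subspace topology of X. *)
Definition open_in (A : finType) (X U : set (config A)) : Prop :=
  exists2 O : set {ptws int * int -> discrete_topology A},
    open O & U = O `&` X.

Definition horizontally_transitive (A : finType) (X : set (config A)) : Prop :=
  forall U W : set (config A),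
    open_in X U -> open_in X W -> U !=set0 -> W !=set0 ->
    exists p : int, (translate (p, 0) @` U) `&` W !=set0.

(* Columns are listed from bottom to top. *)
Definition column (A : finType) (G : graph2 A) (k : nat) : finType :=
  {c : k.-tuple A | sorted (ver G) c}.

Definition col_rel (A : finType) (G : graph2 A) (k : nat) : rel (column G k) :=
  fun c d => [forall t : 'I_k, hor G (tnth (val c) t) (tnth (val d) t)].

Definition Hmx (A : finType) (G : graph2 A) (k : nat) :
    'M[nat]_#|column G k| := adjmx (@col_rel A G k).

Definition irreducible_mx (n : nat) (M : 'M[nat]_n) : Prop :=
  forall i j : 'I_n, exists2 k : nat, (0 < k)%N & (M ^+ k) i j != 0.

Definition principal_sub (n : nat) (M : 'M[nat]_n) (S : {set 'I_n}) :
    'M[nat]_#|S| :=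
  mxsub (fun i : 'I_#|S| => enum_val i) (fun i : 'I_#|S| => enum_val i) M.

(* The empty sub-matrix, which is vacuously irreducible, is excluded. *)
Definition irreducible_sub (n : nat) (M : 'M[nat]_n) (S : {set 'I_n}) : Prop :=
  S != finset.set0 /\ irreducible_mx (principal_sub M S).

(* p lists the vertices after i: the path visits i :: p. *)
Definition mx_path (n : nat) (M : 'M[nat]_n) (i j : 'I_n) (p : seq 'I_n) : Prop :=
  [/\ path (fun u v => M u v != 0) i p, uniq (i :: p) & last i p = j].

(* A1 and A2 are the only irreducible sub-matrices of M, both are permutation
   matrices.  It is not enough that A1 and A2 be the only sub-matrices which are
   irreducible and permutation matrices: in the graph a -> a, a -> t, t -> a,
   t -> b, b -> b the sub-matrix {a, t} is irreducible but not a permutation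
   matrix, and the vertex shift is not transitive. *)
Definition two_irreducible_perm_subs (n : nat) (M : 'M[nat]_n) : Prop :=
  exists A1 A2 : {set 'I_n},
    [/\ A1 != A2,
        forall S : {set 'I_n}, irreducible_sub M S <-> S = A1 \/ S = A2,
        is_perm_mx (principal_sub M A1),
        is_perm_mx (principal_sub M A2) &
        forall i j : 'I_n, i \in A1 -> j \in A2 ->
          exists p : seq 'I_n,
            [/\ mx_path M i j p,
                forall q, mx_path M i j q -> q = p &
                forall v, v \notin finset.setU A1 A2 -> v \in i :: p]].

(* Main.v *)
Require Import Defs.
From HB Require Import structures.
From mathcomp Require Import all_boot all_order all_algebra.
From mathcomp Require Import all_classical all_reals all_analysis.
From mathcomp Require Import perm zify.
Set Implicit Arguments.
Unset Strict Implicit.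
Unset Printing Implicit Defensive.
Import Order.TTheory GRing.Theory Num.Theory.
Local Open Scope classical_set_scope.
Local Open Scope ring_scope.

(** The commutation hypothesis says that a corner, made of a horizontal and a
    vertical edge, always closes up to a unit square.  A bi-infinite horizontal
    walk therefore has a compatible row above it: fill any half-line
    [m <= N] from right to left and let [N] grow, by compactness
    ([row_above], [row_below]).  Hence every bi-infinite walk on the columns of
    height [k] is a horizontal strip of a configuration ([strip_config]), and
    [X_G] is horizontally transitive exactly when, for every [k], the vertex
    shift of [H_k] is transitive under shifts in both directions
    ([transitive_columns], [columns_transitive]).

    For one graph whose vertices all have a successor and a predecessor,
    two-sided transitivity holds in two cases.  Either the graph is irreducible,
    or some forward closed set [S] of vertices is missed by some vertex.  In the
    second case a walk enters [S] at most once, so two walks that enter [S] and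
    occur in a common walk are aligned at the entrance: the walk that enters [S]
    is unique.  This gives a bi-infinite walk [z], called a spine here, that
    contains every finite walk ([transitive_reducible_spine]).  By the same
    alignment, [z] is determined by its crossing edge ([spine_rigid]), so a
    repeated vertex in one tail makes that tail periodic ([spine_periodic]).
    The recurrent vertices of the two tails are the two cycles of the statement,
    and a simple path between them is a segment of [z], which makes it unique
    and forces it through all the other vertices ([spine_two_perm]).
    Conversely, two cycles and a unique path determine a walk that leaves the
    first cycle, and this walk is a spine ([two_perm_spine]).

    It remains to see that the alternative does not depend on [k].
    Irreducibility of [H_k] descends to [H] by projection.  If [H] is
    irreducible, then no [H_k] has a spine ([irreducible_rows_no_spine]): either
    successors in [H] are unique, hence also in [H_k], and a spine, which repeats
    a vertex in its past, would return to its past for ever; or [H] has a vertex with two successors,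
    and a walk on [H] that alternates between two loops of equal length would
    have to occur in a sequence with periodic tails.  So [H] decides between the
    two cases for all [k] at once. *)

(** * Bi-infinite walks *)

(** The points of the vertex shift of [R].  The vertices may form an infinite
    type, as bi-infinite rows do. *)
Definition biwalk (T : Type) (R : T -> T -> Prop) (x : int -> T) : Prop :=
  forall n, R (x n) (x (n + 1)).

(** [essential], for vertices that need not form a finite type. *)
Definition extendable (T : Type) (R : T -> T -> Prop) : Prop :=
  forall v, (exists w, R v w) /\ (exists w, R w v).

Lemma extendable_rev (T : Type) (e : T -> T -> Prop) :
  extendable e -> extendable (fun a b => e b a).
Proof. by move=> ext v; have [] := ext v. Qed.

Section Biwalks.
Variables (T : Type) (R : T -> T -> Prop).

Lemma biwalk_shift x p : biwalk R x -> biwalk R (fun n => x (n + p)).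
Proof. by move=> Rx n; rewrite addrAC; apply: Rx. Qed.

(** The reflection [n |-> 1 - n] exchanges the half-lines [n <= 0] and [0 < n],
    so that statements about one tail of a spine transfer to the other. *)
Lemma biwalk_rev x :
  biwalk R x -> biwalk (fun a b => R b a) (fun n => x (1 - n)).
Proof.
move=> Rx n; have := Rx (- n).
by congr (R (x _) (x _)); lia.
Qed.

Lemma biwalk_glue x y n m : biwalk R x -> biwalk R y -> x n = y m ->
  biwalk R (fun i => if i <= n then x i else y (i - n + m)).
Proof.
move=> Rx Ry xy i; case: (leP i n) => hi; case: (leP (i + 1) n) => hi' //.
- have -> : i = n by lia.
  by rewrite xy; have := Ry m; congr (R (y _) (y _)); lia.
- lia.
- by have := Ry (i - n + m); congr (R (y _) (y _)); lia.
Qed.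

(** A finite walk, continued on both sides by chosen successors and
    predecessors. *)
Lemma biwalk_extend (f : nat -> T) (k : nat) : extendable R ->
    (forall i, (i < k)%N -> R (f i) (f i.+1)) ->
  exists2 y, biwalk R y & forall i : nat, (i <= k)%N -> y i = f i.
Proof.
move=> ext Rf.
have /choice[s sP] : forall v, exists w, R v w by move=> v; case: (ext v).
have /choice[r rP] : forall v, exists w, R w v by move=> v; case: (ext v).
exists (fun n => match n with
  | Posz i => if (i <= k)%N then f i else iter (i - k) s (f k)
  | Negz i => iter i.+1 r (f 0%N) end); last by move=> i /= ->.
move=> [i|[|i]].
- have -> : (i%:Z + 1 = i.+1) by lia.
  case: (ltngtP i k) => [ik|ki|->]; last 2 first.
  + by rewrite /= subSn ?(ltnW ki) //=; apply: sP.
  + by rewrite subSnn; apply: sP.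
  + exact: Rf.
- by rewrite /=; apply: rP.
- have -> : (Negz i.+1 + 1 = Negz i) by lia.
  exact: rP.
Qed.

End Biwalks.

Lemma path_biwalk (T : Type) (e : rel T) x p : extendable e -> path e x p ->
  exists2 y, biwalk e y &
    forall i : nat, (i <= size p)%N -> y i = nth x (x :: p) i.
Proof.
move=> ext /(pathP x) ep.
exact: (@biwalk_extend _ e (nth x (x :: p)) (size p) ext ep).
Qed.

Lemma connect_biwalk (T : finType) (e : rel T) u v :
    extendable e -> connect e u v ->
  exists y, [/\ biwalk e y, y 0 = u & exists l : nat, y l = v].
Proof.
move=> ext /connectP[p ep ->]; have [y ey yE] := path_biwalk ext ep.
exists y; split=> //; first exact: (yE 0%N).
by exists (size p); rewrite yE // -last_nth.
Qed.

Lemma segment_connect (T : finType) (e : rel T) (x : int -> T) m n :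
  m <= n -> (forall i, m <= i < n -> e (x i) (x (i + 1))) ->
  connect e (x m) (x n).
Proof.
move=> mn ex; have En : n = m + `|(n - m)%R|%N by lia.
move: ex; rewrite {}En; elim: {n mn}`|_|%N => [|k IH] ex; first by rewrite addr0.
have En : m + k.+1 = m + k + 1 by lia.
rewrite En; apply: (connect_trans (IH _)); first by move=> i hi; apply: ex; lia.
by apply/connect1/ex; lia.
Qed.

Lemma biwalk_glue_right (T : finType) (e : rel T) x n v :
    extendable e -> biwalk e x -> connect e (x n) v ->
  exists y, [/\ biwalk e y, forall i, i <= n -> y i = x i &
    exists2 m, n <= m & y m = v].
Proof.
move=> ext ex /(connect_biwalk ext)[y [ey y0 [l yl]]].
exists (fun i => if i <= n then x i else y (i - n + 0)); split.
- exact: biwalk_glue.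
- by move=> i ->.
- exists (n + l%:Z); first lia.
  case: leP => h; last by rewrite -yl; congr y; lia.
  have l0 : l = 0%N by lia.
  by rewrite -yl l0 y0; congr x; lia.
Qed.

Lemma biwalk_glue_left (T : finType) (e : rel T) x n u :
    extendable e -> biwalk e x -> connect e u (x n) ->
  exists y, [/\ biwalk e y, forall i, n <= i -> y i = x i &
    exists2 m, m <= n & y m = u].
Proof.
move=> ext ex /(connect_biwalk ext)[y [ey y0 [l yl]]].
exists (fun i : int => if i + (l%:Z - n) <= l%:Z then y (i + (l%:Z - n))
                 else x (i + (l%:Z - n) - l%:Z + n)); split.
- exact: (biwalk_shift _ (biwalk_glue ey ex yl)).
- move=> i ni; case: leP => h; last by congr x; lia.
  have -> : i = n by lia.
  by rewrite -yl; congr y; lia.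
- exists (n - l%:Z); first lia.
  by case: leP => h; [rewrite -y0; congr y; lia|lia].
Qed.

(** Connection by a non-empty walk, as in the definition of irreducibility. *)
Definition tconnect (T : finType) (e : rel T) : rel T :=
  fun x y => [exists w, e x w && connect e w y].

Lemma tconnectP (T : finType) (e : rel T) x y :
  reflect (exists2 w, e x w & connect e w y) (tconnect e x y).
Proof.
by apply: (iffP existsP) => [[w /andP[]]|[w ? ?]]; exists w => //; apply/andP.
Qed.

Lemma tconnectW (T : finType) (e : rel T) x y : tconnect e x y -> connect e x y.
Proof. by case/tconnectP=> w /connect1; apply: connect_trans. Qed.

Lemma tconnect_trans (T : finType) (e : rel T) x y z :
  tconnect e x y -> connect e y z -> tconnect e x z.
Proof.
case/tconnectP=> w exw wy yz; apply/tconnectP.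
by exists w => //; apply: connect_trans yz.
Qed.

Lemma connect_ttrans (T : finType) (e : rel T) x y z :
  connect e x y -> tconnect e y z -> tconnect e x z.
Proof.
move=> /connectP[[|w p] /=]; first by move=> _ ->.
move=> /andP[exw ep] -> yz; apply/tconnectP; exists w => //.
by apply: (connect_trans _ (tconnectW yz)); apply/connectP; exists p.
Qed.

Lemma tconnect_rev (T : finType) (e : rel T) x y :
  tconnect (fun a b => e b a) x y = tconnect e y x.
Proof.
have half (f : rel T) a b : tconnect f a b -> tconnect (fun a b => f b a) b a.
  case/tconnectP=> w fw wb.
  have : connect (fun a b => f b a) b w by rewrite (connect_rev f).
  by move/connect_ttrans; apply; apply/tconnectP; exists a.
by apply/idP/idP => /half.
Qed.

Lemma segment_tconnect (T : finType) (e : rel T) (x : int -> T) m n :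
  m < n -> (forall i, m <= i < n -> e (x i) (x (i + 1))) ->
  tconnect e (x m) (x n).
Proof.
move=> mn ex; apply/tconnectP; exists (x (m + 1)); first by apply: ex; lia.
by apply: segment_connect => [|i hi]; [lia|apply: ex; lia].
Qed.

Lemma biwalk_connect (T : finType) (e : rel T) x m n :
  biwalk e x -> m <= n -> connect e (x m) (x n).
Proof. by move=> ex mn; apply: segment_connect => // i _; apply: ex. Qed.

Lemma biwalk_tconnect (T : finType) (e : rel T) x m n :
  biwalk e x -> m < n -> tconnect e (x m) (x n).
Proof. by move=> ex mn; apply: segment_tconnect => // i _; apply: ex. Qed.

Lemma biwalk_through (T : finType) (e : rel T) v :
  extendable e -> exists2 y, biwalk e y & y 0 = v.
Proof. by move=> ext; have [y []] := connect_biwalk ext (connect0 e v); exists y. Qed.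

(** * Transitive vertex shifts *)

(** Two-sided topological transitivity of the vertex shift of [e], with the
    windows [[-N, N]] in the role of cylinders.  As [p] has any sign, the two
    windows may occur in either order, or overlap. *)
Definition walk_transitive (T : Type) (e : rel T) : Prop :=
  forall x y, biwalk e x -> biwalk e y -> forall N : nat,
  exists w p, [/\ biwalk e w,
    forall i : int, (`|i| <= N)%N -> w i = x i &
    forall i : int, (`|i| <= N)%N -> w (i + p) = y i].

Lemma connected_walk_transitive (T : finType) (e : rel T) :
  extendable e -> (forall x y, connect e x y) -> walk_transitive e.
Proof.
move=> ext con x y ex ey N.
have [w1 [ew1 w1x [m Nm w1y]]] := biwalk_glue_right ext ex (con (x N) (y (- N%:Z))).
exists (fun i => if i <= m then w1 i else y (i - m + - N%:Z)), (m + N%:Z); split.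
- exact: biwalk_glue.
- by move=> i iN; rewrite ifT ?w1x //; lia.
- move=> i iN; case: leP => h; last by congr y; lia.
  have -> : i = - N%:Z by lia.
  by rewrite -w1y; congr w1; lia.
Qed.

(** * Spines *)

(** A walk whose orbit closure is the whole vertex shift, and whose past
    [n <= 0] and future [0 < n] have no vertex in common. *)
Definition spine (T : Type) (R : T -> T -> Prop) (z : int -> T) : Prop :=
  [/\ biwalk R z,
      forall m n, m <= 0 -> 0 < n -> z m <> z n &
      forall x, biwalk R x -> forall N : nat,
        exists p, forall i : int, (`|i| <= N)%N -> x i = z (i + p)].

Lemma spine_rev (T : Type) (R : T -> T -> Prop) z :
  spine R z -> spine (fun a b => R b a) (fun n => z (1 - n)).
Proof.
move=> [Rz sep fac]; split; first exact: biwalk_rev.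
  by move=> m n m0 n0 /esym; apply: sep; lia.
move=> x /biwalk_rev Rx N.
have [p pP] := fac _ Rx N.+1.
exists (- p) => i iN; have := pP (1 - i).
have -> : 1 - (1 - i) = i by lia.
by move=> -> //; [congr z; lia|lia].
Qed.

(** A walk that passes from the past to the future at the same place as [z]
    occurs in [z], and [z] offers only one place for that passage. *)
Lemma spine_rigid (T : Type) (R : T -> T -> Prop) z w m n :
    spine R z -> biwalk R w -> m <= 0 -> 0 < n -> w 0 = z m -> w 1 = z n ->
  w =1 z.
Proof.
move=> [Rz sep fac] Rw m0 n0 wm wn i.
have [p pP] := fac _ Rw `|i|.+1.
have p0 : p = 0.
  have [] := (pP 0, pP 1).
  rewrite wm wn add0r => /(_ isT) zm /(_ isT) zn.
  case: (ltP 0 p) => [/(sep m _ m0)//|hp].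
  case: (leP (1 + p) 0) => [/sep/(_ n0)|]; last lia.
  by rewrite zn.
by rewrite pP ?p0 ?addr0 //; lia.
Qed.

(** Shifting the part of [z] before [j] by [j - i] and leaving the rest unchanged
    gives a walk, because [z i = z j]; it has the crossing edge of [z], so it
    is [z]. *)
Lemma spine_periodic (T : Type) (R : T -> T -> Prop) z i j :
    spine R z -> i < j -> j <= 0 -> z i = z j ->
  forall n, n <= j -> z (n - (j - i)) = z n.
Proof.
move=> sp ij j0 zij n nj; have [Rz _ _] := sp.
have zij' : z (j + (i - j)) = z j by rewrite -zij; congr z; lia.
have Rw := biwalk_glue (biwalk_shift (i - j) Rz) Rz zij'.
rewrite -[RHS](spine_rigid (m := 0) (n := 1) sp Rw) //=.
- by rewrite nj; congr z; lia.
- case: ifPn => h; last by congr z; lia.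
  by have j0' : j = 0 by [lia]; rewrite -{2}j0' -zij; congr z; lia.
- by rewrite ifF; [congr z|]; lia.
Qed.

Lemma spine_walk_transitive (T : Type) (e : rel T) z :
  spine e z -> walk_transitive e.
Proof.
move=> [ez _ fac] x y ex ey N.
have [p xp] := fac _ ex N; have [q yq] := fac _ ey N.
exists (fun i => z (i + p)), (q - p); split; first exact: biwalk_shift.
  by move=> i iN; rewrite xp.
by move=> i iN; rewrite yq //; congr z; lia.
Qed.

Lemma int_crossing (P : int -> Prop) m n :
  ~ P m -> P n -> m <= n -> exists k, ~ P k /\ P (k + 1).
Proof.
move=> Pm Pn mn; have En : n = m + `|(n - m)%R|%N by lia.
move: Pn; rewrite {}En; elim: {n mn}`|_|%N => [|k IH]; first by rewrite addr0.
have -> : m + k.+1 = m + k + 1 by lia.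
by move=> Pk; have [/IH//|nP] := pselect (P (m + k)); exists (m + k).
Qed.

(** The set [S] of vertices reached from [c] is forward closed and misses [d].  By
    transitivity some walk visits both [d] and a vertex of [S], hence it enters
    [S].  That walk, translated so as to enter between 0 and 1, is the spine:
    walks enter [S] at most once, so any occurrence of its windows in a common
    walk is aligned at the entrance. *)
Lemma transitive_reducible_spine (T : finType) (e : rel T) c d :
    extendable e -> walk_transitive e -> ~~ tconnect e c d ->
  exists z, spine e z.
Proof.
move=> ext tr cd; pose S v := tconnect e c v.
have Sup x m n : biwalk e x -> m <= n -> S (x m) -> S (x n).
  by move=> ex mn; move/tconnect_trans; apply; apply: biwalk_connect.
have [x ex x0] := biwalk_through d ext; have [y ey y0] := biwalk_through c ext.
have [w [p [ew wx wy]]] := tr x y ex ey 1%N.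
have wd : ~ S (w 0) by rewrite wx // x0; apply/negP.
have wc : S (w (1 + p)).
  by rewrite wy // /S -y0; apply: biwalk_tconnect.
have [|p0] := leP 0 (1 + p); last by case: wd; apply: Sup wc => //; lia.
move=> /(@int_crossing (fun n => S (w n)) _ _ wd wc)[k [Sk Sk1]].
pose z n := w (n + k).
have ez : biwalk e z by apply: biwalk_shift.
have crossing u : biwalk e u -> forall a b, ~ S (u a) -> S (u (a + 1)) ->
    ~ S (u b) -> S (u (b + 1)) -> a = b.
  move=> eu a b ua ua1 ub ub1; apply/eqP; rewrite eq_le.
  by apply/andP; split; rewrite leNgt; apply/negP => ab;
    [apply: ua; apply: Sup ub1 | apply: ub; apply: Sup ua1] => //; lia.
have zS n : 0 < n -> S (z n) by move=> n0; apply: (Sup _ 1) => //; rewrite /z addrC.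
have zNS n : n <= 0 -> ~ S (z n).
  by move=> n0 /(Sup _ _ 0 ez n0); rewrite /z add0r.
exists z; split=> //.
  by move=> m n /zNS m0 /zS n0 mn; apply: m0; rewrite mn.
move=> {wx x0 ex}x ex N.
have [u [q [eu ux uz]]] := tr x z ex ez N.+1.
(* The offset of z in u is not under control, so u is compared with z again,
   on a window that covers both x and the entrance of u into S. *)
have [u' [r [eu' u'u u'z]]] :=
  tr _ z (biwalk_shift q eu) ez (N + `|q| + 1)%N.
have [uq0 uq1] : ~ S (u q) /\ S (u (q + 1)).
  split; first by rewrite -[q]add0r uz //; apply: zNS.
  by rewrite addrC uz //; apply: zS.
(* u' enters S at q + 0 through u and at q + r through z. *)
have r0 : r = 0.
  apply: (crossing _ eu').
  - by rewrite -[r]add0r u'z //; apply: zNS.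
  - by rewrite addrC u'z //; [apply: zS|lia].
  - by rewrite u'u // add0r.
  - by rewrite add0r u'u ?[1 + q]addrC //; lia.
exists (- q) => i iN.
rewrite -ux; last lia.
by rewrite -u'z ?r0 ?addr0 ?u'u //; [congr u; lia|lia|lia].
Qed.

(** * The two cycles of a spine *)

Definition restr (T : finType) (U : {set T}) (e : rel T) : rel T :=
  fun x y => [&& x \in U, y \in U & e x y].

Definition strongly_connected (T : finType) (e : rel T) (U : {set T}) : Prop :=
  forall x y, x \in U -> y \in U -> tconnect (restr U e) x y.

Lemma strongly_connected_rev (T : finType) (e : rel T) (U : {set T}) :
  strongly_connected e U -> strongly_connected (fun a b => e b a) U.
Proof.
move=> sc x y xU yU; have := sc y x yU xU; rewrite -tconnect_rev.
congr (tconnect _ x y); apply/funext => a; apply/funext => b.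
by rewrite /restr andbCA.
Qed.

Lemma connect_homo (T T' : finType) (e : rel T) (e' : rel T') (f : T -> T') x y :
  (forall a b, e a b -> e' (f a) (f b)) ->
  connect e x y -> connect e' (f x) (f y).
Proof.
move=> ef /connectP[p ep ->]; elim: p x ep => [|a p IH] x /=; first by [].
by case/andP=> /ef/connect1 + /IH; apply: connect_trans.
Qed.

Lemma tconnect_homo (T T' : finType) (e : rel T) (e' : rel T') (f : T -> T') x y :
  (forall a b, e a b -> e' (f a) (f b)) ->
  tconnect e x y -> tconnect e' (f x) (f y).
Proof.
move=> ef /tconnectP[w /ef exw wy]; apply/tconnectP.
by exists (f w) => //; apply: connect_homo wy.
Qed.

Lemma restr_tconnect (T : finType) (e : rel T) (U : {set T}) x y :
  tconnect (restr U e) x y -> tconnect e x y.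
Proof. by apply: (@tconnect_homo _ _ _ _ id) => a b /and3P[]. Qed.

Lemma tconnect_path (T : finType) (e : rel T) x y : tconnect e x y ->
  exists p, [/\ (0 < size p)%N, path e x p & last x p = y].
Proof.
case/tconnectP=> w exw /connectP[p ep ->].
by exists (w :: p); split=> //=; rewrite exw.
Qed.

Section Spine.
Variables (T : finType) (e : rel T) (z : int -> T).
Hypotheses (ext : extendable e) (sp : spine e z).

Let ez : biwalk e z. Proof. by case: sp. Qed.
Let sep (m n : int) : m <= 0 -> 0 < n -> z m <> z n.
Proof. by case: sp => _ + _; apply. Qed.

Definition occurs x p (a : int) : Prop :=
  forall i : nat, (i <= size p)%N -> nth x (x :: p) i = z (a + i).

Lemma spine_path x p : path e x p ->
  exists a, occurs x p a.
Proof.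
move=> /(path_biwalk ext)[y ey yE]; case: sp => _ _ /(_ _ ey (size p))[a aP].
by exists a => i ip; rewrite -yE // aP ?[a + _]addrC //.
Qed.

Lemma spine_edge u v : e u v -> exists a, u = z a /\ v = z (a + 1).
Proof.
move=> uv; have [|a aP] := @spine_path u [:: v]; first by rewrite /= uv.
by exists a; rewrite -(aP 1%N) // -[a]addr0 -(aP 0%N).
Qed.

Lemma spine_surj v : exists m, v = z m.
Proof. by case: (ext v) => -[w /spine_edge[a [-> _]] _]; exists a. Qed.

(** A closed walk at [z m] occurs in [z] and so repeats a vertex there; when the
    repetition lies before [m], the distance from it to [m] is also a period. *)
Lemma spine_recurrent_periodic m : m <= 0 -> tconnect e (z m) (z m) ->
  exists2 c, 0 < c & forall n, n <= m -> z (n - c) = z n.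
Proof.
move=> m0 /tconnect_path[p [p0 ep lp]]; have [a aP] := spine_path ep.
have za : z a = z m by rewrite -[a]addr0 -(aP 0%N).
have zb : z (a + size p) = z m by rewrite -aP // -last_nth.
have b0 : a + size p <= 0.
  by rewrite leNgt; apply/negP => /(sep m0); rewrite zb.
have [mb|bm] := leP m (a + size p).
  exists (size p)%:Z => // n nm.
  have zab : z a = z (a + size p) by rewrite za zb.
  have ab : a < a + (size p)%:Z by lia.
  have -> : n - (size p)%:Z = n - (a + size p - a) by lia.
  by apply: (spine_periodic sp ab b0 zab); apply: le_trans mb.
exists (m - (a + size p)); first lia.
by move=> n nm; apply: (spine_periodic sp).
Qed.

(** The edge [u -> z n] occurs in [z], say at [a]; if [a + 1 <> n], then [z]
    repeats the vertex [z n] in its past and is periodic there, so that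
    [z a = z (n - 1)]. *)
Lemma spine_pred_unique u n : n <= 0 -> e u (z n) -> u = z (n - 1).
Proof.
move=> n0 /spine_edge[a [-> za]].
have a0 : a + 1 <= 0.
  by rewrite leNgt; apply/negP => /(sep n0); rewrite za.
have [an|na|an] := ltgtP (a + 1) n.
- have := spine_periodic sp an n0 (esym za) (n := n - 1).
  by move=> <-; [congr z|]; lia.
- have := spine_periodic sp na a0 za (n := a).
  by move=> <-; [congr z|]; lia.
- by congr z; lia.
Qed.

(** The recurrent vertices of the past: the cycle along which [z] runs as [n]
    tends to minus infinity. *)
Definition lcore : {set T} :=
  [set v | `[< exists2 m, m <= 0 & v = z m >] && tconnect e v v].

Lemma lcoreP v :
  reflect (exists m, [/\ m <= 0, v = z m & tconnect e v v]) (v \in lcore).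
Proof.
rewrite inE; apply: (iffP andP) => [[/asboolP[m m0 vm] vv]|[m [m0 vm vv]]].
  by exists m.
by split=> //; apply/asboolP; exists m.
Qed.

(** Everything before a recurrent vertex of the past is recurrent, by
    periodicity. *)
Lemma lcore_tail m n : m <= 0 -> z m \in lcore -> n <= m -> z n \in lcore.
Proof.
move=> m0 /lcoreP[_ [_ _ zz]] nm.
have [c c0 per] := spine_recurrent_periodic m0 zz.
apply/lcoreP; exists n; split=> //; first lia.
by rewrite -{1}per //; apply: biwalk_tconnect => //; lia.
Qed.

Lemma int_pigeonhole : exists i j, [/\ i < j, j <= 0 & z i = z j].
Proof.
have /injectivePn[i [j ij zij]] : ~~ injectiveb (fun i : 'I_#|T|.+1 => z (- i%:Z)).
  apply/negP => /injectiveP/leq_card.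
  by rewrite card_ord ltnn.
have [h|h|/val_inj h] := ltngtP i j; last by rewrite h eqxx in ij.
  by exists (- j%:Z), (- i%:Z); split=> //; lia.
by exists (- i%:Z), (- j%:Z); split=> //; lia.
Qed.

Lemma lcore_neq0 : exists v, v \in lcore.
Proof.
have [i [j [ij j0 zij]]] := int_pigeonhole.
exists (z j); apply/lcoreP; exists j; split=> //.
by rewrite -{1}zij; apply: biwalk_tconnect.
Qed.

Lemma iter_period m c : (forall n, n <= m -> z (n - c) = z n) -> 0 < c ->
  forall n (t : nat), n <= m -> z (n - c * t) = z n.
Proof.
move=> per c0 n t nm; elim: t => [|t IH]; first by rewrite mulr0 subr0.
rewrite -IH -(per (n - c * t)); last by nia.
by congr z; lia.
Qed.

(** By periodicity, [x] occurs in [z] before [y]; the segment of [z] between these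
    two occurrences stays in [lcore]. *)
Lemma lcore_strongly_connected : strongly_connected e lcore.
Proof.
move=> x y xC yC; case/lcoreP: (xC) => m [m0 xm xx]; subst x.
case/lcoreP: (yC) => m' [m'0 ym' yy]; subst y.
have [c c0 per] := spine_recurrent_periodic m0 xx.
rewrite -(iter_period per c0 (`|m|%N + `|m'|%N + 1)%N (lexx m)).
apply: segment_tconnect => [|i /andP[_ im']]; first nia.
by rewrite /restr ez andbT; apply/andP; split;
  apply: (lcore_tail m'0 yC); lia.
Qed.

(** Predecessors are unique in the past and [U] contains one for each of its
    vertices, so [U] contains the whole tail of [z] before [m], in particular a
    full period of it. *)
Lemma lcore_unique (U : {set T}) m : m <= 0 -> z m \in U ->
  strongly_connected e U -> U = lcore.
Proof.
move=> m0 mU sc; have mm := restr_tconnect (sc _ _ mU mU).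
have [c c0 per] := spine_recurrent_periodic m0 mm.
have Utail (t : nat) : z (m - t%:Z) \in U.
  elim: t => [|t IH]; first by rewrite subr0.
  have := sc _ _ IH IH; rewrite -tconnect_rev => /tconnectP[w].
  case/and3P=> wU _ /spine_pred_unique ew _; move: wU.
  by rewrite ew; [congr (z _ \in U)|]; lia.
apply/setP => v; apply/idP/lcoreP => [vU|[n [n0 -> nn]]].
  have [n vn] := spine_surj v; exists n.
  split=> //; last exact: restr_tconnect (sc _ _ vU vU).
  rewrite leNgt; apply/negP => n0.
  have /tconnect_path[p [_ ep lp]] := restr_tconnect (sc _ _ vU mU).
  have [a aP] := spine_path ep.
  have : a <= 0.
    rewrite leNgt; apply/negP => a0.
    apply: (sep (n := a + size p) m0); first lia.
    by rewrite -aP // -last_nth.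
  by move=> /sep/(_ n0); apply; rewrite -[a]addr0 -(aP 0%N).
have [c' c'0 per'] := spine_recurrent_periodic n0 nn.
have := Utail `|(m - (n - c' * (`|m|%N + `|n|%N)))%R|%N.
rewrite -(iter_period per' c'0 (`|m|%N + `|n|%N) (lexx n)).
congr (z _ \in U); nia.
Qed.

Lemma lcore_pred_unique u u' v : v \in lcore -> e u v -> e u' v -> u = u'.
Proof.
by case/lcoreP=> m [m0 -> _] /(spine_pred_unique m0) -> /(spine_pred_unique m0).
Qed.

(** Both paths are factors of [z] that straddle 0.  A simple path cannot visit its
    first vertex twice, so it starts at the last occurrence of [x] in the
    past; likewise it ends at the first occurrence of [z r] in the future. *)
Lemma spine_simple_path_unique x p q (s r : int) :
    s <= 0 -> 0 < r -> x = z s -> last x p = z r -> last x q = z r ->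
    path e x p -> path e x q -> uniq (x :: p) -> uniq (x :: q) ->
  p = q.
Proof.
move=> s0 r0 xs pr qr ep eq up uq.
have [a aP] := spine_path ep; have [b bP] := spine_path eq.
have start w c : occurs x w c ->
    last x w = z r -> c <= 0 /\ 0 < c + size w.
  move=> cP wr; split.
    rewrite leNgt; apply/negP => /(sep s0); rewrite -xs; apply.
    by rewrite -[c]addr0 -(cP 0%N).
  rewrite ltNge; apply/negP => /sep/(_ r0); rewrite -wr; apply.
  by rewrite -cP // -last_nth.
have [a0 ap] := start _ _ aP pr; have [b0 bq] := start _ _ bP qr.
have first_le w c d : occurs x w c ->
    uniq (x :: w) -> 0 < c + size w -> z d = x -> d <= 0 -> d <= c.
  move=> cP uw cw dx d0; rewrite leNgt; apply/negP => cd.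
  have : nth x (x :: w) `|(d - c)%R|%N = x by rewrite cP -?dx; [congr z|]; lia.
  by move/eqP; rewrite (nth_uniq _ (j := 0%N) _ _ uw) //=; lia.
have zx w c : occurs x w c -> z c = x.
  by move=> cP; rewrite -[c]addr0 -(cP 0%N).
have ab : a = b.
  apply/eqP; rewrite eq_le (first_le _ _ _ bP uq bq (zx _ _ aP) a0).
  by rewrite (first_le _ _ _ aP up ap (zx _ _ bP) b0).
subst b.
have last_le w w' : occurs x w a ->
   occurs x w' a ->
    uniq (x :: w) -> last x w = z r -> last x w' = z r -> (size w <= size w')%N.
  move=> wP w'P uw wr w'r; rewrite leqNgt; apply/negP => ww'.
  have : nth x (x :: w) (size w') = nth x (x :: w) (size w).
    by rewrite wP ?(ltnW ww') // -w'P // -last_nth w'r -wr (last_nth x).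
  by move/eqP; rewrite nth_uniq //= ?ltnS ?(ltnW ww') // => /eqP; lia.
have pq : size p = size q.
  by apply/eqP; rewrite eqn_leq !last_le.
apply: (@eq_from_nth _ x) => // i ip.
by have := aP i.+1 ip; have := bP i.+1; rewrite -pq ip => /(_ isT) /= -> ->.
Qed.

Lemma spine_crossing_path x p (s r : int) :
    s <= 0 -> 0 < r -> x = z s -> last x p = z r -> path e x p ->
  exists a b, [/\ a <= 0, 0 < b, z a = x, z b = last x p &
    forall t, a <= t <= b -> z t \in x :: p].
Proof.
move=> s0 r0 xs pr ep; have [a aP] := spine_path ep.
have za : z a = x by rewrite -[a]addr0 -(aP 0%N).
have zb : z (a + size p) = last x p by rewrite -aP // -last_nth.
exists a, (a + size p); split=> //.
- by rewrite leNgt; apply/negP => /(sep s0); rewrite za xs.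
- by rewrite ltNge; apply/negP => /sep/(_ r0); rewrite zb pr.
move=> t /andP[at_ tb].
have -> : z t = nth x (x :: p) `|(t - a)%R|%N.
  by rewrite aP; [congr z|]; lia.
by apply: mem_nth; rewrite /= ltnS; lia.
Qed.

End Spine.

(** The cycle of the future, by time reversal. *)
Definition rcore (T : finType) (e : rel T) (z : int -> T) : {set T} :=
  lcore (fun a b => e b a) (fun n => z (1 - n)).

(** * Irreducible matrices and walks *)

Definition mx_rel n (M : 'M[nat]_n) : rel 'I_n := fun i j => M i j != 0.

(** There is no cancellation among natural numbers, so an entry of a power is
    non-zero as soon as one walk contributes to it. *)
Lemma mx_expr_neq0 n (M : 'M[nat]_n) k i j : (M ^+ k) i j != 0 <->
  exists p, [/\ size p = k, path (mx_rel M) i p & last i p = j].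
Proof.
elim: k i => [|k IH] i.
  rewrite expr0 mxE; split=> [|[p [/size0nil -> _ /= ->]]]; last by rewrite eqxx.
  by case: (i =P j) => [-> _|_]; [exists [::]|rewrite eqxx].
rewrite exprS mxE; split.
  apply: contra_neqP => noP; apply: big1 => l _.
  have [->|Mil] := eqVneq (M i l) 0; first by rewrite mul0r.
  have [->|Mlj] := eqVneq ((M ^+ k) l j) 0; first by rewrite mulr0.
  have [p [pk ep lp]] := (IH l).1 Mlj.
  by case: noP; exists (l :: p); split=> //=; [rewrite pk|rewrite /mx_rel Mil].
move=> [[|l p] [//= [pk] /andP[Mil ep] lp]].
have /IH Mlj : exists p, [/\ size p = k, path (mx_rel M) l p & last l p = j].
  by exists p.
rewrite (bigD1 l) //= -[0]/0%N -[_ + _]/(_ + _)%N addn_eq0 negb_and.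
by rewrite -[M i l * _]/(M i l * _)%N muln_eq0 negb_or Mlj andbT; apply/orP; left.
Qed.

Lemma irreducible_mxP n (M : 'M[nat]_n) :
  irreducible_mx M <-> forall i j, tconnect (mx_rel M) i j.
Proof.
split=> irr i j.
  have [k k0 /mx_expr_neq0[[|l p] [pk ep lp]]] := irr i j.
    by rewrite -pk in k0.
  case/andP: ep => il ep.
  by apply/tconnectP; exists l => //; apply/connectP; exists p.
have [p [p0 ep lp]] := tconnect_path (irr i j).
by exists (size p) => //; apply/mx_expr_neq0; exists p.
Qed.

Lemma irreducible_subP n (M : 'M[nat]_n) (U : {set 'I_n}) :
  irreducible_sub M U <->
  U != finset.set0 /\ strongly_connected (mx_rel M) U.
Proof.
have valE i j : mx_rel (principal_sub M U) i j =
    mx_rel M (enum_val i) (enum_val j) by rewrite /mx_rel mxE.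
split=> -[U0 irr]; split=> //.
  move=> x y xU yU.
  have := (irreducible_mxP _).1 irr (enum_rank_in xU x) (enum_rank_in xU y).
  move=> /(@tconnect_homo _ _ _ (restr U (mx_rel M)) enum_val).
  rewrite !enum_rankK_in //; apply=> a b.
  by rewrite valE /restr !enum_valP.
apply/irreducible_mxP => i j.
have := irr _ _ (enum_valP i) (enum_valP j).
move=> /(@tconnect_homo _ _ _ (mx_rel (principal_sub M U))
  (enum_rank_in (enum_valP i))).
rewrite !enum_valK_in; apply=> a b /and3P[aU bU ab].
by rewrite valE !enum_rankK_in.
Qed.

(** Choosing a non-zero entry in each row gives an injective map, hence a
    permutation. *)
Lemma perm_mx_intro n (M : 'M[nat]_n) : (forall i j, (M i j <= 1)%N) ->
    (forall i, exists j, M i j != 0) ->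
    (forall i i' j, M i j != 0 -> M i' j != 0 -> i = i') -> is_perm_mx M.
Proof.
move=> M1 row col; have /choice[f fP] := row.
have f_inj : injective f by move=> i i' ff'; apply: (col _ _ (f i)); rewrite // ff'.
apply/is_perm_mxP; exists (perm f_inj); apply/matrixP => i j; rewrite !mxE permE.
case: eqVneq => [<-|fij]; first by move: (M1 i (f i)) (fP i); case: (M _ _) => [|[]].
apply/eqP; apply: contraNT fij => Mij.
rewrite -(f_invF f_inj j) in Mij *; apply/eqP; congr f.
exact: col Mij (fP _).
Qed.

(** * From a spine to two cycles and a unique path *)

Section SpineMatrix.
Variables (n : nat) (M : 'M[nat]_n) (z : int -> 'I_n).
Hypotheses (ext : extendable (mx_rel M)) (M1 : forall i j, (M i j <= 1)%N).
Hypothesis sp : spine (mx_rel M) z.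

Let e := mx_rel M.
Let ext' : extendable (fun i j => mx_rel M j i) := extendable_rev ext.
Let sp' : spine (fun i j => mx_rel M j i) (fun k => z (1 - k)) := spine_rev sp.

Let rcore_sc : strongly_connected e (rcore e z).
Proof. exact: strongly_connected_rev (lcore_strongly_connected ext' sp'). Qed.

Lemma rcoreP v :
  reflect (exists m, [/\ 0 < m, v = z m & tconnect e v v]) (v \in rcore e z).
Proof.
apply: (iffP (lcoreP _ _ _)) => -[m [m0 -> zz]]; exists (1 - m); split; try lia.
- by [].
- by rewrite -tconnect_rev.
- by congr z; lia.
- by rewrite tconnect_rev.
Qed.

(** A vertex of [U] lies in the past or in the future of [z], and the uniqueness
    of the core applies on that side. *)
Lemma strongly_connected_core (U : {set 'I_n}) : U != finset.set0 ->
  strongly_connected e U -> U = lcore e z \/ U = rcore e z.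
Proof.
case/set0Pn=> x xU sc; have [m xm] := spine_surj ext sp x; subst x.
have [m0|m0] := leP m 0; first by left; apply: lcore_unique xU sc.
right; apply: (@lcore_unique _ _ _ ext' sp' _ (1 - m)); first lia.
  by rewrite opprB addrC subrK.
exact: strongly_connected_rev.
Qed.

(** In the past, predecessors are unique, which bounds the columns of the first
    sub-matrix; strong connectedness provides an entry in each row.  The second
    sub-matrix is the transpose of this situation.  A simple path from one core to
    the other is a segment of [z], and a vertex of [z] outside that segment lies
    beyond a recurrent vertex, so it belongs to a core. *)
Lemma spine_two_perm : two_irreducible_perm_subs M.
Proof.
exists (lcore e z), (rcore e z); split.
- apply/eqP => lr; have [v vl] := lcore_neq0 sp.
  have := vl; rewrite lr => /rcoreP[m [m0 vm _]].
  have [k [k0 vk _]] := lcoreP _ _ _ vl.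
  by case: sp => _ /(_ k m k0 m0) + _; apply; rewrite -vk.
- move=> U; rewrite irreducible_subP; split=> [[]|].
    exact: strongly_connected_core.
  case=> ->; split=> //.
  + by have [v vl] := lcore_neq0 sp; apply/set0Pn; exists v.
  + exact: lcore_strongly_connected.
  + by have [v vl] := lcore_neq0 sp'; apply/set0Pn; exists v.
- apply: perm_mx_intro => [i j|i|i i' j]; rewrite ?mxE //.
  + have xU := enum_valP i.
    have /tconnectP[w /and3P[_ wU ew] _] :=
      lcore_strongly_connected ext sp xU xU.
    by exists (enum_rank_in wU w); rewrite mxE enum_rankK_in.
  + move=> Mi Mi'; apply: enum_val_inj.
    exact: (lcore_pred_unique ext sp (enum_valP j) Mi Mi').
- rewrite -is_perm_mx_tr.
  apply: perm_mx_intro => [i j|i|i i' j]; rewrite ?mxE //.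
  + have xU := enum_valP i.
    have := rcore_sc xU xU; rewrite -tconnect_rev => /tconnectP[w].
    case/and3P=> wU _ ew _.
    by exists (enum_rank_in wU w); rewrite !mxE enum_rankK_in.
  + move=> Mi Mi'; apply: enum_val_inj.
    exact: (lcore_pred_unique ext' sp' (enum_valP j) Mi Mi').
- move=> i j iL jR; have [s [s0 is_ ii]] := lcoreP _ _ _ iL.
  have [r [r0 jr jj]] := rcoreP _ jR.
  have /connectP[p' ep' lp'] : connect e i j.
    by rewrite is_ jr; apply: biwalk_connect; [case: sp|lia].
  move: lp'; case/shortenP: ep' => p ep up _ jp; exists p; split.
  + by split.
  + move=> q [eq uq lq].
    apply: (spine_simple_path_unique ext sp s0 r0 is_ _ _ eq ep uq up).
      by rewrite lq.
    by rewrite -jp.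
  + move=> v; have [t vt] := spine_surj ext sp v; subst v.
    have [|a [b [a0 b0 za zb mem_p]]] := spine_crossing_path ext sp s0 r0 is_ _ ep.
      by rewrite -jp.
    rewrite inE negb_or => /andP[tL tR]; apply: mem_p.
    rewrite leNgt leNgt; apply/andP; split; apply/negP => tab.
      case/negP: tL; apply: (lcore_tail ext sp a0); last exact: ltW.
      by rewrite za.
    case/negP: tR; rewrite -[t](subKr 1).
    apply: (lcore_tail ext' sp' (m := 1 - b)); [lia| |lia].
    by rewrite subKr zb -jp.
Qed.

End SpineMatrix.

(** * From two cycles and a unique path to a spine *)

Lemma connect_in_path (T : finType) (e : rel T) x p v : path e x p ->
  v \in x :: p -> connect e x v /\ connect e v (last x p).
Proof.
move=> ep vp; split; first exact: path_connect ep _ vp.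
case/splitPl: vp ep => p1 p2 <-; rewrite cat_path last_cat => /andP[_ ep2].
by apply/connectP; exists p2.
Qed.

Lemma connect_uniq_path (T : finType) (e : rel T) x y : connect e x y ->
  exists p, [/\ path e x p, uniq (x :: p) & last x p = y].
Proof. by case/connectP=> p /shortenP[q eq uq _] ->; exists q. Qed.

Definition component (T : finType) (e : rel T) (v : T) : {set T} :=
  [set w | connect e v w && connect e w v].

Lemma component_strongly_connected (T : finType) (e : rel T) v :
  tconnect e v v -> strongly_connected e (component e v).
Proof.
move=> vv x y xC yC; have [w [+ wx]] : exists w, e x w /\ connect e w y.
  move: xC yC; rewrite !inE => /andP[_ xv] /andP[vy _].
  have /tconnectP[w xw wy] := tconnect_trans (connect_ttrans xv vv) vy.
  by exists w.
have step u u' : u \in component e v -> e u u' -> connect e u' y ->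
    u' \in component e v.
  move: yC; rewrite !inE => /andP[_ yv] /andP[vu _] uu' u'y.
  by rewrite (connect_trans vu (connect1 uu')) (connect_trans u'y yv).
move=> xw; have wC := step _ _ xC xw wx.
apply/tconnectP; exists w; first by rewrite /restr xC wC.
case/connectP: wx => p; elim: p w {xw} wC => [|u p IH] w wC /=; first by move=> _ ->.
case/andP=> wu ep lp; have uC : u \in component e v.
  by apply: step wC wu _; apply/connectP; exists p.
by apply: connect_trans (IH u uC ep lp); apply/connect1; rewrite /restr wC uC.
Qed.

(** As [V] is a component that meets [U], it contains [U].  Successors in [V] are
    unique, and [U] contains a successor of each of its vertices: a walk in [V]
    cannot leave [U]. *)
Lemma component_of_core (T : finType) (e : rel T) (U V : {set T}) a :
    strongly_connected e U -> strongly_connected e V ->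
    (forall x y y', x \in V -> y \in V -> y' \in V -> e x y -> e x y' -> y = y') ->
    a \in U -> component e a = V ->
  U = V.
Proof.
move=> scU scV row aU aV; apply/eqP; rewrite finset.eqEsubset.
have UV : U \subset V.
  apply/fintype.subsetP => x xU; rewrite -aV inE.
  by rewrite !(tconnectW (restr_tconnect (scU _ _ _ _))).
rewrite UV; apply/fintype.subsetP => y yV.
have /connectP[p] := tconnectW (scV _ _ (fintype.subsetP UV _ aU) yV).
elim: p a aU {aV} => [|w p IH] a aU /=; first by move=> _ ->.
case/andP=> /and3P[aV wV aw] ep; apply: IH ep.
have /tconnectP[w' /and3P[_ w'U aw'] _] := scU _ _ aU aU.
by rewrite (row a w w') // (fintype.subsetP UV).
Qed.

Lemma absz_window (i : int) (N : nat) : (`|i| <= N)%N -> - N%:Z <= i /\ i <= N.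
Proof. by lia. Qed.

Section TwoCycles.
Variables (T : finType) (e : rel T) (A1 A2 : {set T}).
Hypothesis ext : extendable e.
Hypothesis A12 : A1 != A2.
Hypothesis cores : forall U : {set T},
  U != finset.set0 /\ strongly_connected e U <-> U = A1 \/ U = A2.
Hypothesis row : forall U x y y', U = A1 \/ U = A2 -> x \in U -> y \in U -> y' \in U ->
  e x y -> e x y' -> y = y'.
Hypothesis col1 : forall x x' y, x \in A1 -> x' \in A1 -> y \in A1 ->
  e x y -> e x' y -> x = x'.
Hypothesis simple_path : forall i j, i \in A1 -> j \in A2 ->
  exists p, [/\ [/\ path e i p, uniq (i :: p) & last i p = j],
    forall q, [/\ path e i q, uniq (i :: q) & last i q = j] -> q = p &
    forall v, v \notin A1 :|: A2 -> v \in i :: p].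

Let sc U : U = A1 \/ U = A2 -> strongly_connected e U.
Proof. by move/cores=> []. Qed.

(** The component of [a] is strongly connected, so it is one of the two cores, and
    neither core is a proper part of the other. *)
Lemma core_component U a : U = A1 \/ U = A2 -> a \in U -> component e a = U.
Proof.
move=> UA aU; have aa := restr_tconnect (sc UA aU aU).
have /cores cA : component e a != finset.set0 /\
    strongly_connected e (component e a).
  split; last exact: component_strongly_connected.
  by apply/set0Pn; exists a; rewrite inE !connect0.
have H V : V = A1 \/ V = A2 -> component e a = V -> U = V.
  move=> VA; apply: component_of_core aU; [exact: sc|exact: sc|].
  by move=> x y y'; apply: row.
by case: cA => cA; rewrite (H _ _ cA) //; [left|right].
Qed.

Let in1 a w : a \in A1 -> connect e a w -> connect e w a -> w \in A1.
Proof.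
by move=> aA aw wa; rewrite -(core_component (or_introl erefl) aA) inE aw wa.
Qed.

Let in2 a w : a \in A2 -> connect e a w -> connect e w a -> w \in A2.
Proof.
by move=> aA aw wa; rewrite -(core_component (or_intror erefl) aA) inE aw wa.
Qed.

(** A vertex outside the two cores lies on the simple path from [a] to [b]. *)
Lemma connect_from1_to2 a b v : a \in A1 -> b \in A2 ->
  connect e a v /\ connect e v b.
Proof.
move=> aA bA; have [p [[ep up lp] _ cover]] := simple_path aA bA.
have ab : connect e a b by apply/connectP; exists p.
have core U x y : U = A1 \/ U = A2 -> x \in U -> y \in U -> connect e x y.
  by move=> UA xU yU; apply/tconnectW/restr_tconnect/(sc UA xU yU).
have [v1|v1] := boolP (v \in A1).
  split; first exact: core (or_introl erefl) aA v1.
  by apply: connect_trans ab; apply: core (or_introl erefl) v1 aA.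
have [v2|v2] := boolP (v \in A2).
  split; last exact: core (or_intror erefl) v2 bA.
  by apply: (connect_trans ab); apply: core (or_intror erefl) bA v2.
by rewrite -lp; apply: connect_in_path ep (cover _ _); rewrite inE negb_or v1.
Qed.

Let core_neq0 U : U = A1 \/ U = A2 -> exists a, a \in U.
Proof. by move=> /cores[/set0Pn]. Qed.

Let closed1 u v : v \in A1 -> connect e u v -> u \in A1.
Proof.
move=> v1; have [b bA] := core_neq0 (or_intror erefl).
by apply: in1 => //; case: (connect_from1_to2 u v1 bA).
Qed.

Let closed2 u v : u \in A2 -> connect e u v -> v \in A2.
Proof.
move=> u2 uv; have [a aA] := core_neq0 (or_introl erefl).
by apply: in2 uv _ => //; case: (connect_from1_to2 v aA u2).
Qed.

Let disj v : v \in A1 -> v \in A2 -> False.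
Proof.
move=> v1 v2; move: A12; rewrite -(core_component (or_introl erefl) v1).
by rewrite (core_component (or_intror erefl) v2) eqxx.
Qed.

Let simple_outside b j : b \notin A1 -> j \in A2 ->
  exists q, [/\ path e b q, uniq (b :: q), last b q = j &
    forall y, y \in A1 -> y \notin b :: q].
Proof.
move=> b1 j2; have [a aA] := core_neq0 (or_introl erefl).
have [q [eq uq lq]] := connect_uniq_path (connect_from1_to2 b aA j2).2.
exists q; split=> // y y1; apply: contra b1 => yq.
exact: closed1 y1 (connect_in_path eq yq).1.
Qed.

(** Each exit edge [a -> b] from [A1] extends to a simple path to [j], as no walk
    returns to [A1].  Preceded by a simple path from [a] to [a'] inside [A1], the
    exit at [a'] gives another simple path from [a] to [j].  The two coincide, and
    they leave [A1] at the same step. *)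
Lemma exit_unique a a' b b' : a \in A1 -> a' \in A1 ->
  b \notin A1 -> b' \notin A1 -> e a b -> e a' b' -> a = a' /\ b = b'.
Proof.
move=> a1 a'1 b1 b'1 ab a'b'; have [j j2] := core_neq0 (or_intror erefl).
have [p [_ puniq _]] := simple_path a1 j2.
have [q [eq uq lq qA]] := simple_outside b1 j2.
have [q' [eq' uq' lq' q'A]] := simple_outside b'1 j2.
have bqp : b :: q = p.
  by apply: puniq; split; rewrite //= ?ab // -/(uniq (b :: q)) uq (qA a a1).
have [c [ec uc lc]] : exists p, [/\ path e a p, uniq (a :: p) & last a p = a'].
  exact/connect_uniq_path/tconnectW/restr_tconnect/(sc (or_introl erefl) a1 a'1).
have cA y : y \in a :: c -> y \in A1.
  by move=> yc; apply: closed1 a'1 _; rewrite -lc; case: (connect_in_path ec yc).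
have cp : c ++ b' :: q' = p.
  apply: puniq; split; first by rewrite cat_path ec lc /= a'b'.
    rewrite -cat_cons cat_uniq uc uq' andbT andTb; apply/hasPn => y yq.
    by apply: contraL yq => yc; apply: q'A; apply: cA.
  by rewrite last_cat.
case: c lc cp cA {ec uc} => [<-|y c lc]; rewrite -bqp => -[] // -> _ cA.
by move: b1; rewrite cA // !inE eqxx orbT.
Qed.

(** Outside both cores [v] lies on no closed walk.  So a simple path from [A1] to
    [v], an edge [v -> u] and a simple path from [u] to [A2] never meet again, and
    they form a simple path, which is unique. *)
Lemma succ_outside_unique v w w' : v \notin A1 -> e v w -> e v w' -> w = w'.
Proof.
move=> v1 vw vw'; have [v2|v2] := boolP (v \in A2).
  have in2' u : e v u -> u \in A2 by move=> /connect1; apply: closed2.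
  exact: row (or_intror erefl) v2 (in2' _ vw) (in2' _ vw') vw vw'.
have [a a1] := core_neq0 (or_introl erefl).
have [j j2] := core_neq0 (or_intror erefl).
have [p [_ puniq _]] := simple_path a1 j2.
have acyclic u : e v u -> ~~ connect e u v.
  move=> vu; apply/negP => uv.
  have vv : tconnect e v v by apply/tconnectP; exists u.
  have vC : v \in component e v by rewrite inE connect0.
  have /cores[] : component e v != finset.set0 /\
      strongly_connected e (component e v).
    by split; [apply/set0Pn; exists v|apply: component_strongly_connected].
  - by move=> cA; rewrite -cA vC in v1.
  - by move=> cA; rewrite -cA vC in v2.
have [c [ec uc lc]] := connect_uniq_path (connect_from1_to2 v a1 j2).1.
have through u : e v u -> exists q, c ++ u :: q = p.
  move=> vu; have [q [eq uq lq]] := connect_uniq_path (connect_from1_to2 u a1 j2).2.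
  exists q; apply: puniq; split; first by rewrite cat_path ec lc /= vu.
    rewrite -cat_cons cat_uniq uc uq andbT andTb; apply/hasPn => y yq.
    apply: contra (acyclic _ vu) => yc.
    apply: (connect_trans (connect_in_path eq yq).1).
    by rewrite -lc; exact: (connect_in_path ec yc).2.
  by rewrite last_cat.
have [q qp] := through _ vw; have [q' /eqP] := through _ vw'.
by rewrite -qp eqseq_cat // => /andP[_ /eqP[-> _]].
Qed.

(** The exit edge of [A1] is unique; forward of it successors are unique, backward
    of it, inside [A1], predecessors are. *)
Lemma crossing_unique x y : biwalk e x -> biwalk e y ->
    x 0 \in A1 -> x 1 \notin A1 -> y 0 \in A1 -> y 1 \notin A1 ->
  x =1 y.
Proof.
move=> ex ey x0 x1 y0 y1.
have out u n : biwalk e u -> u 1 \notin A1 -> 1 <= n -> u n \notin A1.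
  by move=> eu u1 n1; apply: contra u1 => /closed1; apply; apply: biwalk_connect.
have into u n : biwalk e u -> u 0 \in A1 -> n <= 0 -> u n \in A1.
  by move=> eu u0 n0; apply: closed1 u0 _; apply: biwalk_connect.
have [xy0 xy1] := exit_unique x0 y0 x1 y1 (ex 0) (ey 0).
have right (k : nat) : x (k%:Z + 1) = y (k%:Z + 1).
  elim: k => [|k IH]; first by rewrite add0r.
  have -> : k.+1%:Z + 1 = k%:Z + 1 + 1 by lia.
  apply: (@succ_outside_unique (x (k%:Z + 1))); [|exact: ex|].
    by apply: out => //; lia.
  by rewrite IH; apply: ey.
have left (k : nat) : x (- k%:Z) = y (- k%:Z).
  elim: k => [|k IH]; first by rewrite oppr0.
  have E : - k%:Z = - k.+1%:Z + 1 by lia.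
  apply: (@col1 _ _ (x (- k%:Z))).
  - by apply: into => //; lia.
  - by apply: into => //; lia.
  - by apply: into => //; lia.
  - by rewrite E; apply: ex.
  - by rewrite IH E; apply: ey.
move=> n; have [n0|n0] := leP n 0.
  have -> : n = - `|n|%N%:Z by lia.
  exact: left.
have -> : n = `|n|.-1%:Z + 1 by lia.
exact: right.
Qed.

(** Every window of a walk can be continued to a walk from [A1] to [A2], since
    every vertex is reached from [A1] and reaches [A2]; up to translation there is
    only one such walk. *)
Lemma two_cycles_spine : exists z, spine e z.
Proof.
have [a a1] := core_neq0 (or_introl erefl).
have [j j2] := core_neq0 (or_intror erefl).
have j1 : j \notin A1 by apply/negP => /disj/(_ j2).
have crossing x m n : biwalk e x -> x m = a -> x n = j -> m <= n ->
    exists k, x k \in A1 /\ x (k + 1) \notin A1.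
  move=> ex xm xn mn; have [||k [k0 k1]] :=
    @int_crossing (fun n => x n \notin A1) m n _ _ mn; rewrite ?xm ?xn //.
    by rewrite a1.
  by exists k; split=> //; apply/negPn/negP.
have [y [ey y0 [l yl]]] := connect_biwalk ext (connect_from1_to2 j a1 j2).1.
have [k [yk yk1]] := crossing y 0 l ey y0 yl isT.
pose z n := y (n + k).
have ez : biwalk e z by apply: biwalk_shift.
have z0 : z 0 \in A1 by rewrite /z add0r.
have z1 : z 1 \notin A1 by rewrite /z addrC.
exists z; split=> //.
  move=> m n m0 n0 mn; case/negP: z1.
  apply: (@closed1 _ (z n)); last by apply: biwalk_connect => //; lia.
  by rewrite -mn; apply: closed1 z0 _; apply: biwalk_connect.
move=> x ex N.
have [w [ew wx [m Nm wm]]] :=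
  biwalk_glue_right ext ex (connect_from1_to2 (x N) a1 j2).2.
have aw : connect e a (w (- N%:Z)) by case: (connect_from1_to2 (w (- N%:Z)) a1 j2).
have [u [eu uw [m' m'N um']]] := biwalk_glue_left ext ew aw.
have [NN _] : - N%:Z <= N%:Z /\ N%:Z <= N by apply: absz_window.
have um : u m = j by rewrite uw //; apply: le_trans Nm.
have [|h [uh uh1]] := crossing u m' m eu um' um.
  exact: le_trans m'N (le_trans NN Nm).
have uz : (fun n => u (n + h)) =1 z.
  by apply: crossing_unique => //; [apply: biwalk_shift|rewrite add0r|rewrite addrC].
exists (- h) => i /absz_window[Ni iN].
by rewrite -uz subrK uw // wx.
Qed.

End TwoCycles.

Lemma perm_mx_elim n (M : 'M[nat]_n) i j k : is_perm_mx M -> M i j != 0 ->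
  (M i k != 0 -> j = k) /\ (M k j != 0 -> i = k).
Proof.
case/is_perm_mxP=> s ->; rewrite !mxE; case: (s i =P j) => // <- _.
split; first by case: (s i =P k).
by case: (s k =P s i) => // /perm_inj.
Qed.

Lemma two_perm_spine n (M : 'M[nat]_n) : extendable (mx_rel M) ->
  two_irreducible_perm_subs M -> exists z, spine (mx_rel M) z.
Proof.
move=> ext [A1 [A2 [A12 irr perm1 perm2 simple]]].
have permU U : U = A1 \/ U = A2 -> is_perm_mx (principal_sub M U) by case=> ->.
have uniqU U x y : U = A1 \/ U = A2 -> x \in U -> y \in U -> mx_rel M x y ->
    forall w, w \in U -> (mx_rel M x w -> y = w) /\ (mx_rel M w y -> x = w).
  move=> /permU pU xU yU xy w wU; pose r := enum_rank_in xU.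
  have E u v : u \in U -> v \in U -> principal_sub M U (r u) (r v) = M u v.
    by move=> uU vU; rewrite mxE !enum_rankK_in.
  have [] := @perm_mx_elim _ _ (r x) (r y) (r w) pU; first by rewrite E.
  rewrite !E // => h1 h2; split=> [/h1|/h2] rE;
    by rewrite -(enum_rankK_in xU wU) -[LHS](enum_rankK_in xU) // -/r rE.
apply: (two_cycles_spine ext A12 (A2 := A2)) => //.
- by move=> U; rewrite -irreducible_subP.
- move=> U x y y' UA xU yU y'U xy.
  by have [] := uniqU U x y UA xU yU xy y' y'U.
- move=> x x' y xU x'U yU xy.
  by have [] := uniqU A1 x y (or_introl erefl) xU yU xy x' x'U.
Qed.

(** * Cylinders *)

(** Central squares are cofinal among the finite sets of sites, so the
    sets [agree_on N x] form a neighbourhood basis at [x]. *)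
Definition agree_on (A : finType) (N : nat) (x u : config A) : Prop :=
  forall m n : int, (`|m| <= N)%N -> (`|n| <= N)%N -> u (m, n) = x (m, n).

Lemma agree_on_trans (A : finType) N (x u v : config A) :
  agree_on N x u -> agree_on N u v -> agree_on N x v.
Proof. by move=> xu uv m n mN nN; rewrite uv // xu. Qed.

Lemma nbhs_agree_on (A : finType) (N : nat) (x : config A) :
  nbhs (x : {ptws int * int -> discrete_topology A}) [set u | agree_on N x u].
Proof.
pose c (i : 'I_(N + N).+1) : int := i%:Z - N%:Z.
pose f (ij : 'I_(N + N).+1 * 'I_(N + N).+1) : set (config A) :=
  [set u | u (c ij.1, c ij.2) = x (c ij.1, c ij.2)].
have : nbhs (x : {ptws int * int -> discrete_topology A}) (fun u => forall ij, f ij u).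
  apply: (@filter_forall _ _ f _ (@nbhs_filter {ptws _ -> _} x)) => -[i j] /=.
  have := @proj_continuous _ (fun _ => discrete_topology A) (c i, c j) x.
  by move=> /(_ _ (discrete_set1 _)).
apply: filterS => u ux m n mN nN.
have mE : (`|(m + N%:Z)%R| < (N + N).+1)%N by lia.
have nE : (`|(n + N%:Z)%R| < (N + N).+1)%N by lia.
have cm : c (Ordinal mE) = m by rewrite /c /=; lia.
have cn : c (Ordinal nE) = n by rewrite /c /=; lia.
by have := ux (Ordinal mE, Ordinal nE); rewrite /f /= cm cn.
Qed.

Lemma open_agree_on (A : finType) (N : nat) (x : config A) :
  open ([set u | agree_on N x u] : set {ptws int * int -> discrete_topology A}).
Proof.
rewrite openE => u xu; apply: filterS (nbhs_agree_on N u) => v uv.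
exact: agree_on_trans xu uv.
Qed.

Lemma open_contains_agree_on (A : finType)
    (O : set {ptws int * int -> discrete_topology A}) (x : config A) :
  open O -> O x -> exists N, [set u | agree_on N x u] `<=` O.
Proof.
move=> oO Ox.
pose F : set_system {ptws int * int -> discrete_topology A} :=
  [set P | exists N, [set u | agree_on N x u] `<=` P].
have FF : Filter F.
  split.
  - by exists 0%N.
  - move=> P Q [N NP] [N' NQ]; exists (maxn N N') => u xu; split.
      by apply: NP => m n mN nN; apply: xu; rewrite leq_max ?mN ?nN.
    by apply: NQ => m n mN nN; apply: xu; rewrite leq_max ?mN ?nN orbT.
  - by move=> P Q PQ [N NP]; exists N; apply: subset_trans PQ.
have : F --> (x : {ptws int * int -> discrete_topology A}).
  apply/cvg_sup => -[m n]; apply/cvg_image.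
    by rewrite eqEsubset; split=> // a _; exists (fun _ => a).
  move=> Q /principal_filterP Qx.
  exists [set u | Q (u (m, n))].
    by exists (maxn `|m| `|n|) => u xu /=; rewrite xu ?leq_maxl ?leq_maxr.
  by rewrite eqEsubset; split=> [a [u Qu <-]//|a Qa]; exists (fun _ => a).
by move=> /(_ O); apply; apply: open_nbhs_nbhs.
Qed.

Lemma translateE (A : finType) p q (x : config A) m n :
  translate (p, q) x (m, n) = x (m + p, n + q).
Proof. by []. Qed.

(** * Rows above and below a row *)

(** Compactness of the space of rows, in the form used for edges: take the limit of
    [c] along an ultrafilter finer than the filter at infinity. *)
Lemma pointwise_limit (A : finType) (c : nat -> int -> A) :
  exists x : int -> A, forall m : int, forall N : nat,
    exists n, [/\ (N <= n)%N, c n m = x m & c n (m + 1) = x (m + 1)].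
Proof.
have [U [UU ooU]] := @ultraFilterLemma _ \oo _.
have UF : ProperFilter U by apply: ultra_proper.
have /choice[x xP] : forall m, exists a, U [set n | c n m = a].
  move=> m; apply: contrapT => noa.
  have : U (fun n => forall a, c n m <> a).
    apply: filter_forall => a.
    by have [Ua|//] := in_ultra_setVsetC [set n | c n m = a] UU; case: noa; exists a.
  by move=> /filter_ex[n /(_ (c n m))].
exists x => m N.
have UN : U [set n | (N <= n)%N] by apply: ooU; apply: nbhs_infty_ge.
have UI : U ([set n | (N <= n)%N] `&`
    ([set n | c n m = x m] `&` [set n | c n (m + 1) = x (m + 1)])).
  by apply: filterI => //; apply: filterI.
have [n [Nn [n0 n1]]] := filter_ex UI.
by exists n.
Qed.

(** One half of the commutation hypothesis: the non-zero entries of the product of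
    [h] by [v] are non-zero in the product of [v] by [h]. *)
Definition completes (A : Type) (h v : rel A) : Prop :=
  forall a b c, h a b -> v b c -> exists2 d, v a d & h d c.

(** Rotating a square by a half-turn exchanges its two halves. *)
Lemma completes_rev (A : Type) (h v : rel A) : completes h v ->
  completes (fun a b => v b a) (fun a b => h b a).
Proof. by move=> hv a b c ba cb; have [d] := hv _ _ _ cb ba; exists d. Qed.

(** The vertex above [r m] is obtained from the vertex above [r (m + 1)] by
    completing a corner.  Starting from the right end [N] fills [m <= N], and
    the rows for growing [N] accumulate at a row defined for all [m]. *)
Lemma row_above (A : finType) (h v : rel A) r :
    completes h v -> (forall a, exists b, v a b) -> biwalk h r ->
  exists2 s, biwalk h s & forall m, v (r m) (s m).
Proof.
move=> hv vtot hr; have /choice[g gP] : forall mb : int * A, exists d,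
    v (r (mb.1 + 1)) mb.2 -> v (r mb.1) d /\ h d mb.2.
  move=> [m b] /=; have [vb|] := boolP (v (r (m + 1)) b); last by exists b.
  by have [d] := hv _ _ _ (hr m) vb; exists d.
have /choice[f fP] := vtot.
pose fix s (N : nat) (i : nat) : A :=
  if i is i'.+1 then g (N%:Z - i%:Z, s N i') else f (r N).
have sV N i : v (r (N%:Z - i%:Z)) (s N i).
  elim: i => [|i IH] /=; first by rewrite subr0.
  have [|//] := gP (N%:Z - i.+1%:Z, s N i).
  by rewrite /= (_ : N%:Z - i.+1%:Z + 1 = N%:Z - i%:Z) //; lia.
have sH N i : h (s N i.+1) (s N i).
  have [|//] := gP (N%:Z - i.+1%:Z, s N i).
  by rewrite /= (_ : N%:Z - i.+1%:Z + 1 = N%:Z - i%:Z) //; lia.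
have [y yP] := pointwise_limit (fun N m => s N `|(N%:Z - m)%R|%N).
exists y => m; have [N [mN ym ym1]] := yP m `|m|.+1.
  rewrite -ym -ym1.
  have -> : `|(N%:Z - m)%R|%N = `|(N%:Z - (m + 1))%R|.+1 by lia.
  exact: sH.
by rewrite -ym; have := sV N `|(N%:Z - m)%R|%N; congr (v (r _) _); lia.
Qed.

Lemma row_below (A : finType) (h v : rel A) r :
    completes v h -> (forall a, exists b, v b a) -> biwalk h r ->
  exists2 s, biwalk h s & forall m, v (s m) (r m).
Proof.
move=> vh vtot /biwalk_rev hr.
have [s hs sv] := row_above (completes_rev vh) vtot hr.
exists (fun n => s (1 - n)); first exact: biwalk_rev hs.
by move=> m; have := sv (1 - m); rewrite subKr.
Qed.

(** * Strips and columns *)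

Section Strips.
Variables (A : finType) (G : graph2 A).
Hypotheses (hV : essential (ver G)).
Hypotheses (hv : completes (hor G) (ver G)) (vh : completes (ver G) (hor G)).

(** A configuration is a bi-infinite walk on the graph whose vertices are the
    bi-infinite rows, and this graph is extendable. *)
Lemma rows_config (f : nat -> int -> A) (k : nat) :
    (forall i, (i <= k)%N -> biwalk (hor G) (f i)) ->
    (forall i, (i < k)%N -> forall m, ver G (f i m) (f i.+1 m)) ->
  exists2 x, shift_space G x &
    forall (i : nat) m, (i <= k)%N -> x (m, i%:Z) = f i m.
Proof.
move=> fH fV; pose row := {r | biwalk (hor G) r}.
pose R (r s : row) := forall m, ver G (sval r m) (sval s m).
have ext : extendable R.
  move=> [r hr]; split.
    have [s hs rs] := row_above hv (fun a => (hV a).1) hr.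
    by exists (exist _ s hs).
  have [s hs rs] := row_below vh (fun a => (hV a).2) hr.
  by exists (exist _ s hs).
pose F i : row := exist _ (f (minn i k)) (fH _ (geq_minr i k)).
have [|y yR yF] := biwalk_extend (f := F) (k := k) ext.
  by move=> i ik m; rewrite /= (minn_idPl ik) (minn_idPl (ltnW ik)); apply: fV.
exists (fun mn => sval (y mn.2) mn.1).
  by move=> m n /=; split; [case: (y n) => r /=; apply|apply: yR].
by move=> i m ik; rewrite /= yF //= (minn_idPl ik).
Qed.

Lemma strip_config k (X : int -> column G k.+1) : biwalk (@col_rel A G k.+1) X ->
  exists2 x, shift_space G x &
    forall m (t : 'I_k.+1), x (m, t%:Z) = tnth (val (X m)) t.
Proof.
move=> hX; pose f i m := nth (thead (val (X m))) (val (X m)) i.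
have fE m (t : 'I_k.+1) : f t m = tnth (val (X m)) t by rewrite /f -tnth_nth.
have [||x xG xf] := @rows_config f k.
- move=> i ik m; have := forallP (hX m) (Ordinal (ik : (i < k.+1)%N)).
  by rewrite -!fE.
- move=> i ik m; have := valP (X m) => /sortedP; apply.
  by rewrite size_tuple.
by exists x => // m t; rewrite xf ?fE // -ltnS.
Qed.

Lemma shift_space_translate a x :
  shift_space G x -> shift_space G (translate a x).
Proof.
case: a => p q xG m n; rewrite !translateE.
by rewrite [m + 1 + p]addrAC [n + 1 + q]addrAC; apply: xG.
Qed.

Lemma config_strip k x (n0 : int) : shift_space G x ->
  exists2 X, biwalk (@col_rel A G k) X &
    forall m (t : 'I_k), tnth (val (X m)) t = x (m, n0 + t%:Z).
Proof.
move=> xG; have /choice[X XP] : forall m, exists c : column G k,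
    forall t : 'I_k, tnth (val c) t = x (m, n0 + t%:Z).
  move=> m; pose c := [tuple x (m, n0 + (t : 'I_k)%:Z) | t < k].
  have cV : sorted (ver G) c.
    apply/(sortedP (x (m, 0))) => i; rewrite size_tuple => ik.
    rewrite (nth_mktuple _ _ (Ordinal (ltnW ik))) (nth_mktuple _ _ (Ordinal ik)) /=.
    by have [_] := xG m (n0 + i); congr (ver G _ (x (_, _))); lia.
  by exists (exist _ c cV) => t; rewrite tnth_mktuple.
exists X => // m; apply/forallP => t; rewrite !XP.
by have [] := xG m (n0 + t%:Z).
Qed.

End Strips.

(** A successor of a column is built from the top vertex downwards: each new vertex
    completes the corner that goes up in [c] and then right. *)
Lemma column_succ (A : finType) (h v : rel A) x0 (c : seq A) :
    completes v h -> (forall a, exists b, h a b) -> sorted v c ->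
  exists d, [/\ size d = size c, sorted v d &
    forall i, (i < size c)%N -> h (nth x0 c i) (nth x0 d i)].
Proof.
move=> vh htot; elim: c => [|a c IH] cV; first by exists [::].
have [d [dc dV hd]] := IH (path_sorted cV).
have [b [hab vb]] : exists b, h a b /\ path v b d.
  case: c d cV dc dV hd {IH} => [|a' c] [|b' d] //= cV _ dV hd.
    by have [b ab] := htot a; exists b.
  have [aa' _] := andP cV.
  by have [b ab bb'] := vh _ _ _ aa' (hd 0%N isT); exists b; rewrite bb'.
by exists (b :: d); split=> //= [|[|i]]; [rewrite dc| |exact: hd].
Qed.

Section Transitivity.
Variables (A : finType) (G : graph2 A).
Hypotheses (hH : essential (hor G)) (hV : essential (ver G)).
Hypotheses (hv : completes (hor G) (ver G)) (vh : completes (ver G) (hor G)).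

(** Predecessors of columns are successors in the graph turned by 180 degrees, in
    which columns are read from top to bottom. *)
Lemma column_extendable k : extendable (@col_rel A G k.+1).
Proof.
move=> [c cV]; pose x0 := thead c; split.
  have [d [dc dV hd]] := column_succ x0 vh (fun a => (hH a).1) cV.
  have dk : size d == k.+1 by rewrite dc size_tuple.
  exists (exist _ (Tuple dk) dV); apply/forallP => t.
  by rewrite !(tnth_nth x0); apply: hd; rewrite size_tuple.
have cV' : sorted (fun a b => ver G b a) (rev c) by rewrite rev_sorted.
have [d [dc dV hd]] :=
  column_succ x0 (completes_rev hv) (fun a => (hH a).2) cV'.
rewrite size_rev size_tuple in dc hd.
have dk : size (rev d) == k.+1 by rewrite size_rev dc.
have dV' : sorted (ver G) (Tuple dk) by rewrite /= rev_sorted.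
exists (exist _ (Tuple dk) dV'); apply/forallP => t.
rewrite !(tnth_nth x0) /= nth_rev dc //.
have tk : (k.+1 - t.+1 < k.+1)%N by rewrite ltn_subrL.
have := hd _ tk; rewrite nth_rev size_tuple //.
by congr (hor G _ (nth x0 c _)); have := ltn_ord t; lia.
Qed.

Lemma agree_on_open_in N (x : config A) :
  open_in (shift_space G) ([set u | agree_on N x u] `&` shift_space G).
Proof. by exists [set u | agree_on N x u] => //; apply: open_agree_on. Qed.

(** Cylinders of [X_G] on squares that contain the window [[-N, N]] of the strip see
    both strips, and transitivity of [X_G] produces a configuration whose strip
    contains both windows. *)
Lemma transitive_columns k : horizontally_transitive (shift_space G) ->
  walk_transitive (@col_rel A G k.+1).
Proof.
move=> tr X Y hX hY N.
have [x xG xX] := strip_config hV hv vh hX.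
have [y yG yY] := strip_config hV hv vh hY.
pose M := maxn N k.
have [||p [_ [[u [xu uG] <-]] [yu _]]] :=
  tr _ _ (agree_on_open_in M x) (agree_on_open_in M y).
- by exists x.
- by exists y.
have [W hW Wu] := config_strip k.+1 0 uG.
have tk (t : 'I_k.+1) : (`|t%:Z| <= k)%N by rewrite absz_nat -ltnS.
exists W, p; split=> // i iN; apply/val_inj/eq_from_tnth => t; rewrite Wu.
  by rewrite add0r xu ?xX // leq_max ?iN ?tk ?orbT.
rewrite -yY -yu ?leq_max ?iN ?tk ?orbT //.
by rewrite translateE addr0 add0r.
Qed.

(** Open sets contain cylinders on the square of half-side [N], whose rows [-N .. N]
    form a strip of height [2 N + 1]. *)
Lemma columns_transitive :
  (forall k, walk_transitive (@col_rel A G k.+1)) ->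
  horizontally_transitive (shift_space G).
Proof.
move=> tr U W [V oV ->] [V' oV' ->] [x [Vx xG]] [y [V'y yG]] {U W}.
have [N1 xV] := open_contains_agree_on oV Vx.
have [N2 yV'] := open_contains_agree_on oV' V'y.
pose N := maxn N1 N2.
have agree1 u : agree_on N x u -> V u.
  by move=> xu; apply: xV => m n mN nN; apply: xu; rewrite leq_max ?mN ?nN.
have agree2 u : agree_on N y u -> V' u.
  by move=> yu; apply: yV' => m n mN nN; apply: yu; rewrite leq_max ?mN ?nN orbT.
have [X hX Xx] := config_strip (N + N).+1 (- N%:Z) xG.
have [Y hY Yy] := config_strip (N + N).+1 (- N%:Z) yG.
have [W [p [hW WX WY]]] := tr _ X Y hX hY N.
have [w wG wW] := strip_config hV hv vh hW.
pose u := translate (0, N%:Z) w.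
have uG : shift_space G u by apply: shift_space_translate.
have uE m n : (`|n| <= N)%N -> exists2 t : 'I_(N + N).+1,
    u (m, n) = tnth (val (W m)) t & n = - N%:Z + t%:Z.
  move=> nN; have tN : (`|(n + N%:Z)%R| < (N + N).+1)%N by lia.
  exists (Ordinal tN); last by rewrite /=; lia.
  by rewrite -wW /u translateE addr0; congr (w (_, _)); rewrite /=; lia.
exists p, (translate (p, 0) u); split; last split.
- exists u => //; split=> //; apply: agree1 => m n mN nN.
  by have [t -> ->] := uE m n nN; rewrite WX // Xx.
- apply: agree2 => m n mN nN.
  have -> : translate (p, 0) u (m, n) = u (m + p, n).
    by rewrite translateE addr0.
  by have [t -> ->] := uE (m + p) n nN; rewrite WY // Yy.
- exact: shift_space_translate.
Qed.

(** * Irreducible rows *)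

(** The loop through the edge [a -> b], repeated for ever. *)
Lemma closed_walk (T : finType) (e : rel T) a b : e a b -> connect e b a ->
  exists f : nat -> T, exists2 l : nat, (0 < l)%N &
    [/\ forall i, e (f i) (f i.+1), f 1%N = b &
        forall t i, f (l * t + i)%N = f i] /\ f 0%N = a.
Proof.
move=> ab /connectP[p ep lp]; pose l := (size p).+1.
pose f i := nth a (a :: b :: p) (i %% l)%N.
exists f, l => //; split=> //; split.
- move=> i.
  have step : e (nth a (a :: b :: p) (i %% l)) (nth a (a :: b :: p) (i %% l).+1).
    have /(pathP a) : path e a (b :: p) by rewrite /= ab.
    by apply; rewrite ltn_pmod.
  suff -> : f i.+1 = nth a (a :: b :: p) (i %% l).+1 by [].
  rewrite /f -addn1 -modnDml addn1.
  have [lt|] := ltnP (i %% l).+1 l; first by rewrite modn_small.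
  move=> le; have -> : (i %% l).+1 = l by apply/eqP; rewrite eqn_leq le ltn_pmod.
  by rewrite modnn -[l]/(size (b :: p)) -(last_nth a a (b :: p)).
- by rewrite /f /l; case: p ep lp {l f} => [|c p] //= _ ->.
- by move=> t i; rewrite /f mulnC modnMDl.
Qed.

(** If successors in [hor G] are unique, then so are successors of columns, and a
    vertex repeated in the past of [z] makes the future return to the past.
    Otherwise two loops at [a] start with distinct edges [a -> b] and [a -> c];
    a walk alternating between them, over segments of equal length [L],
    must occur in the bottom row of [z].  When [L] is a common period of both tails,
    [b = c] as soon as the walk covers two segments of one tail. *)
Lemma irreducible_rows_no_spine k z : spine (@col_rel A G k.+1) z ->
  (forall a b, tconnect (hor G) a b) -> False.
Proof.
move=> sp irr; have [zH sep fac] := sp.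
have [i [j [ij j0 zij]]] := int_pigeonhole z.
have [i' [j' [ij' j'0 zij']]] := int_pigeonhole (fun n => z (1 - n)).
pose z' m := tnth (val (z m)) ord0.
have row_factor a : biwalk (hor G) a -> forall N : nat,
    exists p, forall i : int, (`|i| <= N)%N -> a i = z' (i + p).
  move=> ha N; have [|//|x xG xa] := @rows_config _ _ hV hv vh (fun _ => a) 0.
    by [].
  have [X hX Xx] := config_strip k.+1 0 xG.
  have [p pP] := fac _ hX N; exists p => m mN.
  by rewrite /z' -pP // Xx addr0 xa.
have [fun_h|] := pselect (forall a b c, hor G a b -> hor G a c -> b = c).
  have same (n : nat) : z (i + n) = z (j + n).
    elim: n => [|n IH]; first by rewrite !addr0.
    apply/val_inj/eq_from_tnth => t; apply: (fun_h (tnth (val (z (i + n))) t)).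
      by have /forallP/(_ t) := zH (i + n); congr (hor G _ (tnth (val (z _)) t)); lia.
    rewrite IH.
    by have /forallP/(_ t) := zH (j + n); congr (hor G _ (tnth (val (z _)) t)); lia.
  by apply: sep (same `|(1 - j)%R|%N); lia.
move=> /existsNP[a /existsNP[b /existsNP[c /not_implyP[ab /not_implyP[ac bc]]]]].
have [f [l l0 [[fh f1 fl] f0]]] := closed_walk ab (tconnectW (irr b a)).
have [g [r r0 [[gh g1 gl] g0]]] := closed_walk ac (tconnectW (irr c a)).
pose q := `|(j - i)%R|%N; pose q' := `|(j' - i')%R|%N.
(* L is a multiple of the periods of both tails and of the lengths of both loops;
   the factor 2 makes it exceed 1, so that position 1 lies inside a segment. *)
pose L := (2 * q * q' * l * r)%N.
have fL t s : f (L * t + s)%N = f s.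
  by rewrite -(fl (2 * q * q' * r * t)%N s); congr f; rewrite /L; lia.
have gL t s : g (L * t + s)%N = g s.
  by rewrite -(gl (2 * q * q' * l * t)%N s); congr g; rewrite /L; lia.
have L1 : (1 < L)%N by rewrite /L /q /q'; nia.
pose F s := if odd (s %/ L) then g s else f s.
have Fh s : hor G (F s) (F s.+1).
  have meet : (L %| s.+1)%N -> f s.+1 = a /\ g s.+1 = a.
    by case/dvdnP=> d ->; rewrite mulnC -[(L * d)%N]addn0 fL gL.
  rewrite /F divnS; last by lia.
  have := fh s; have := gh s.
  have [/meet[-> ->]|_] := boolP (L %| s.+1)%N; last by case: ifP.
  by rewrite !if_same; case: ifP.
have FE t : F (L * t + 1)%N = if odd t then c else b.
  have -> : F (L * t + 1)%N = if odd t then g 1%N else f 1%N.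
    by rewrite /F fL gL mulnC divnMDl ?divn_small ?addn0 //; lia.
  by rewrite f1 g1.
pose K := (`|j| + `|j'| + L + 2)%N.
have [y hy yF] := biwalk_extend (f := F) (k := (L * (2 * K).+1 + 1)%N)
  (fun a => hH a) (fun s _ => Fh s).
have [p yp] := row_factor y hy (L * (2 * K).+1 + 1)%N.
have Fp s : (s <= L * (2 * K).+1 + 1)%N -> F s = z' (s%:Z + p).
  by move=> sK; rewrite -yF // yp.
have left n : n <= j -> z' (n - L%:Z) = z' n.
  move=> nj; have per := spine_periodic sp ij j0 zij.
  rewrite /z' -(iter_period per _ (2 * q' * l * r) nj); last lia.
  by congr (tnth (val (z _)) _); rewrite /L /q; nia.
have right n : 1 - j' <= n -> z' (n + L%:Z) = z' n.
  move=> nj; have per := spine_periodic (spine_rev sp) ij' j'0 zij'.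
  have nj' : 1 - n <= j' by lia.
  have := iter_period per _ (2 * q * l * r) nj'; rewrite subKr /z' => <-; last lia.
  by congr (tnth (val (z _)) _); rewrite /L /q'; nia.
have contra t : (t <= K)%N -> z' ((L * (2 * t) + 1)%:Z + p) =
    z' ((L * (2 * t).+1 + 1)%:Z + p) -> False.
  move=> tK; rewrite -!Fp; [|nia|nia].
  by rewrite !FE /= oddM.
(* Where the walk starts in z decides which tail it reaches: if it starts in
   the periodic part of the past, compare its first two segments, otherwise two
   segments at the far end. *)
have [pl|pr] := leP (p + L%:Z + 1) j.
  apply: (contra 0%N) => //; rewrite -[RHS]left; last lia.
  by congr z'; lia.
apply: (contra K) => //; rewrite -[LHS]right; last by rewrite /K; nia.
by congr z'; lia.
Qed.

End Transitivity.

(** * The main equivalence *)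

Lemma spine_transport (T T' : Type) (R : T -> T -> Prop) (R' : T' -> T' -> Prop)
    (f : T -> T') (g : T' -> T) z :
    cancel f g -> cancel g f -> (forall a b, R' (f a) (f b) <-> R a b) ->
  spine R z -> spine R' (fun n => f (z n)).
Proof.
move=> fK gK RR' [Rz sep fac]; split.
- by move=> n; apply/RR'.
- by move=> m n m0 n0 /(can_inj fK); apply: sep.
- move=> x R'x N; have [|p pP] := fac (fun n => g (x n)) _ N.
    by move=> n; apply/RR'; rewrite !gK.
  by exists p => i iN; rewrite -pP ?gK.
Qed.

Section AdjacencyMatrix.
Variables (T : finType) (e : rel T).

Lemma adjmx_rel i j : mx_rel (adjmx e) i j = e (enum_val i) (enum_val j).
Proof. by rewrite /mx_rel mxE; case: (e _ _). Qed.

Lemma adjmx_rank a b : mx_rel (adjmx e) (enum_rank a) (enum_rank b) = e a b.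
Proof. by rewrite adjmx_rel !enum_rankK. Qed.

Lemma adjmx_extendable : extendable e -> extendable (mx_rel (adjmx e)).
Proof.
move=> ext i; have [[w ew] [u ue]] := ext (enum_val i).
by split; [exists (enum_rank w)|exists (enum_rank u)];
  rewrite adjmx_rel enum_rankK.
Qed.

Lemma adjmx_spine : (exists z, spine e z) <-> (exists z, spine (mx_rel (adjmx e)) z).
Proof.
split=> -[z sp].
  exists (fun n => enum_rank (z n)).
  apply: spine_transport sp; [exact: enum_rankK|exact: enum_valK|].
  by move=> a b; rewrite adjmx_rank.
exists (fun n => enum_val (z n)).
apply: spine_transport sp; [exact: enum_valK|exact: enum_rankK|].
by move=> a b; rewrite adjmx_rel.
Qed.

Lemma adjmx_irreducible :
  irreducible_mx (adjmx e) <-> forall a b, tconnect e a b.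
Proof.
rewrite irreducible_mxP; split=> irr a b.
  rewrite -(enum_rankK a) -(enum_rankK b).
  by apply: (tconnect_homo _ (irr _ _)) => i j; rewrite adjmx_rel.
rewrite -(enum_valK a) -(enum_valK b).
by apply: (tconnect_homo _ (irr _ _)) => i j; rewrite adjmx_rank.
Qed.

Lemma adjmx_two_spine : extendable e ->
  two_irreducible_perm_subs (adjmx e) <-> exists z, spine e z.
Proof.
move=> /adjmx_extendable ext; rewrite adjmx_spine; split.
  exact: two_perm_spine.
case=> z; apply: spine_two_perm => // i j.
by rewrite mxE; case: (e _ _).
Qed.

End AdjacencyMatrix.

Lemma mul_adjmx (A : finType) (e f : rel A) a b :
  (adjmx e *m adjmx f) (enum_rank a) (enum_rank b) != 0 <->
  exists2 c, e a c & f c b.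
Proof.
rewrite mxE; split.
  apply: contra_neqP => noc; apply: big1 => k _; rewrite !mxE !enum_rankK.
  case eac: (e a _); last by rewrite mul0r.
  case fcb: (f _ b); last by rewrite mulr0.
  by case: noc; exists (enum_val k).
case=> c ac cb; rewrite (bigD1 (enum_rank c)) //= !mxE !enum_rankK ac cb.
by rewrite -[0]/0%N -[_ + _]/(_ + _)%N addn_eq0.
Qed.

(** Every vertex is the bottom of some column, and walks on columns project to walks
    on their bottom vertices. *)
Lemma irreducible_columns_rows (A : finType) (G : graph2 A) k :
    essential (ver G) -> (forall c d, tconnect (@col_rel A G k.+1) c d) ->
  forall a b, tconnect (hor G) a b.
Proof.
move=> hV irr a b.
have [f fV] := choice (fun a => (hV a).1).
have column_of x : exists c : column G k.+1, tnth (val c) ord0 = x.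
  pose c := [tuple iter i f x | i < k.+1]; have cV : sorted (ver G) c.
    apply/(sortedP x) => i; rewrite size_tuple => ik.
    by rewrite (nth_mktuple _ _ (Ordinal (ltnW ik))) (nth_mktuple _ _ (Ordinal ik)) /=.
  by exists (exist _ c cV); rewrite tnth_mktuple.
have [c <-] := column_of a; have [d <-] := column_of b.
apply: (@tconnect_homo _ _ _ _ (fun u : column G k.+1 => tnth (val u) ord0)
  _ _ _ (irr c d)) => u v /forallP; exact.
Qed.

Theorem corollary5 (A : finType) (G : graph2 A)
  (hX : shift_space G !=set0)
  (hH : essential (hor G)) (hV : essential (ver G))
  (hHV : forall i j : 'I_#|A|,
     (adjmx (hor G) *m adjmx (ver G)) i j != 0 <->
     (adjmx (ver G) *m adjmx (hor G)) i j != 0) :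
  horizontally_transitive (shift_space G) <->
  (forall k : nat, (0 < k)%N -> irreducible_mx (Hmx G k)) \/
  (forall k : nat, (0 < k)%N -> two_irreducible_perm_subs (Hmx G k)).
Proof.
have hv : completes (hor G) (ver G).
  by move=> a b c ab bc; apply/mul_adjmx/hHV/mul_adjmx; exists b.
have vh : completes (ver G) (hor G).
  by move=> a b c ab bc; apply/mul_adjmx/hHV/mul_adjmx; exists b.
have ext := column_extendable hH hv vh.
split; last first.
  move=> cases; apply: columns_transitive => // k; case: cases => /(_ k.+1 isT).
    move=> /adjmx_irreducible irr; apply: connected_walk_transitive => // c d.
    exact: tconnectW.
  by case/(adjmx_two_spine (ext k))=> z; apply: spine_walk_transitive.
move=> tr; have trk k := transitive_columns hV hv vh (k := k) tr.
have reducible_spine k : ~ (forall c d, tconnect (@col_rel A G k.+1) c d) ->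
    exists z, spine (@col_rel A G k.+1) z.
  move=> /existsNP[c /existsNP[d /negP cd]].
  exact: transitive_reducible_spine (ext k) (trk k) cd.
have [irr|red] := pselect (forall a b, tconnect (hor G) a b); [left|right].
  move=> [//|k] _; apply/adjmx_irreducible; apply: contrapT => /reducible_spine[z].
  by move=> /(irreducible_rows_no_spine hH hV hv vh); apply.
move=> [//|k] _; apply/(adjmx_two_spine (ext k))/reducible_spine => irr.
exact/red/(irreducible_columns_rows hV irr).
Qed.
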